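(* Let $\mathcal{H}$ be a finite graph with no induced cycle $C_k$ for every $k\geq 4$. Then $\mathcal{H}$ is a shortest path graph if and only if $\mathcal{H}$ is a tree of cliques.
   Context: All graphs are simple and finite. For a graph $G$ and distinct $a,b\in V(G)$, an $(a,b)$-geodesic is a shortest path from $a$ to $b$ in $G$. The shortest path graph $S(G,a,b)$ has as vertices the $(a,b)$-geodesics of $G$, two being adjacent iff their vertex sets differ in exactly one vertex. A graph is a shortest path graph (SPG) if it is isomorphic to $S(G,a,b)$ for some graph $G$ and distinct $a,b\in V(G)$. A graph is $H$-free if it has no induced subgraph isomorphic to $H$. A tree of cliques is a graph that is $C_k$-free for all $k\geq 4$, claw-free ($K_{1,3}$-free), and in which any two distinct maximal cliques share at most one vertex (it may be disconnected). *)

(* Defs.v *)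
From mathcomp Require Import all_boot.

Set Implicit Arguments.
Unset Strict Implicit.
Unset Printing Implicit Defensive.

Record sgraph := SGraph {
  svertex :> finType;
  sedge : rel svertex;
  sedge_sym : symmetric sedge;
  sedge_irrefl : irreflexive sedge }.

Definition graph_iso (G H : sgraph) : Prop :=
  exists f : G -> H,
    bijective f /\ forall x y : G, sedge (f x) (f y) = sedge x y.

Section InducedSubgraph.
Variables (G : sgraph) (A : {set G}).

Definition induced_edge : rel {x : G | x \in A} :=
  fun u v => sedge (val u) (val v).

Lemma induced_edge_sym : symmetric induced_edge.
Proof. by move=> u v; apply: sedge_sym. Qed.

Lemma induced_edge_irrefl : irreflexive induced_edge.
Proof. by move=> u; apply: sedge_irrefl. Qed.

Definition induced_subgraph : sgraph :=
  SGraph induced_edge_sym induced_edge_irrefl.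

End InducedSubgraph.

Definition graph_free (F G : sgraph) : Prop :=
  ~ exists A : {set G}, graph_iso (induced_subgraph A) F.

Section CycleGraph.
Variable k : nat.

(* [ordS] is the cyclic successor on ['I_k].  The conjunct [i != j] only
   matters for [k = 1]; for [k >= 3] this is the usual cycle on k vertices. *)
Definition cycle_edge : rel 'I_k :=
  fun i j => (i != j) && ((j == ordS i) || (i == ordS j)).

Lemma cycle_edge_sym : symmetric cycle_edge.
Proof. by move=> i j; rewrite /cycle_edge eq_sym orbC. Qed.

Lemma cycle_edge_irrefl : irreflexive cycle_edge.
Proof. by move=> i; rewrite /cycle_edge eqxx. Qed.

Definition cycle_graph : sgraph := SGraph cycle_edge_sym cycle_edge_irrefl.

End CycleGraph.

Section CompleteBipartite.
Variables m n : nat.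

Definition bipartite_edge : rel ('I_m + 'I_n)%type :=
  fun u v => match u, v with
             | inl _, inr _ | inr _, inl _ => true
             | _, _ => false
             end.

Lemma bipartite_edge_sym : symmetric bipartite_edge.
Proof. by case=> i [] j. Qed.

Lemma bipartite_edge_irrefl : irreflexive bipartite_edge.
Proof. by case. Qed.

Definition complete_bipartite : sgraph :=
  SGraph bipartite_edge_sym bipartite_edge_irrefl.

End CompleteBipartite.

Definition claw : sgraph := complete_bipartite 1 3.

Definition clique (G : sgraph) (K : {set G}) : bool :=
  [forall x in K, forall y in K, (x != y) ==> sedge x y].

Definition maximal_clique (G : sgraph) (K : {set G}) : bool :=
  maxset (@clique G) K.

Definition tree_of_cliques (G : sgraph) : Prop :=
  [/\ forall k, 4 <= k -> graph_free (cycle_graph k) G,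
      graph_free claw G
    & forall K L : {set G}, maximal_clique K -> maximal_clique L ->
        K != L -> #|K :&: L| <= 1].

Section ShortestPathGraph.
Variables (G : sgraph) (a b : G).

(* As in [path], a path is given by its vertices after the initial vertex a. *)
Definition is_path (p : seq G) : bool :=
  [&& path (@sedge G) a p, last a p == b & uniq (a :: p)].

(* The vertices of a path are distinct, so bounding the length by #|G| loses
   no path and makes the type of candidates finite. *)
Definition geodesic (p : {bseq #|G| of G}) : bool :=
  is_path p && [forall q : {bseq #|G| of G}, is_path q ==> (size p <= size q)].

Definition path_vertices (p : seq G) : {set G} := [set x in a :: p].

Definition spg_vertex : finType := {p : {bseq #|G| of G} | geodesic p}.

(* All geodesics have the same number of vertices, so vertex sets that differ
   in exactly one vertex each have exactly one vertex outside the other. *)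
Definition spg_edge : rel spg_vertex :=
  fun u v =>
    let P := path_vertices (val u) in
    let Q := path_vertices (val v) in
    (#|P :\: Q| == 1) && (#|Q :\: P| == 1).

Lemma spg_edge_sym : symmetric spg_edge.
Proof. by move=> u v; rewrite /spg_edge andbC. Qed.

Lemma spg_edge_irrefl : irreflexive spg_edge.
Proof. by move=> u; rewrite /spg_edge setDv cards0. Qed.

(* When a and b lie in different components this is the null graph. *)
Definition shortest_path_graph : sgraph :=
  SGraph spg_edge_sym spg_edge_irrefl.

End ShortestPathGraph.

Definition is_spg (H : sgraph) : Prop :=
  exists (G : sgraph) (a b : G), a != b /\ graph_iso H (shortest_path_graph a b).

(* Main.v *)
Require Import Defs.
From mathcomp Require Import all_boot.
From mathcomp Require Import zify.

Set Implicit Arguments.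
Unset Strict Implicit.
Unset Printing Implicit Defensive.

(** Read a geodesic as the word of its vertices, level by level: two geodesics
    are adjacent iff their words differ at a single level, and two words that
    agree at a level can be spliced there.  A triangle uses one level only,
    which makes maximal cliques sharing two vertices equal; a claw uses three
    levels, two of which are not consecutive, and splicing then yields an
    induced four-cycle.

    Conversely, it suffices to 2-colour the edges of a tree of cliques so that
    two edges at a common vertex get the same colour iff their other ends are
    adjacent: each colour is then a disjoint union of cliques, and [H] is the
    line graph of the bipartite graph [B] whose sides are the cliques of either
    colour, hence the shortest path graph of [B] with [a] joined to one side
    and [b] to the other.  The colouring is built by adding vertices one at a
    time: the two cliques around the new vertex lie in different components,
    since otherwise there would be a long induced cycle, so the colours can be
    flipped on one of them. *)

(** * Induced subgraphs as embeddings, and local forms of the clique and claw conditions *)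

Lemma embedding_not_free (F G : sgraph) (h : F -> G) :
  injective h -> (forall x y, sedge (h x) (h y) = sedge x y) ->
  ~ graph_free F G.
Proof.
move=> h_inj hE; apply; exists [set h x | x in F].
have hP x : h x \in [set h x | x in F] by exact: imset_f.
pose g (x : F) : induced_subgraph [set h x | x in F] := Sub (h x) (hP x).
have g_inj : injective g by move=> x y /(congr1 val) /h_inj.
have [|f gK fK] := inj_card_bij g_inj.
  by rewrite card_sig -(card_imset _ h_inj) subset_leq_card //; apply/subsetP.
exists f; split; first by exists g.
by move=> x y; rewrite -{2}[x]fK -{2}[y]fK [RHS]hE.
Qed.

Lemma not_free_embedding (F G : sgraph) (A : {set G}) :
  graph_iso (induced_subgraph A) F ->
  exists2 h : F -> G, injective h & forall x y, sedge (h x) (h y) = sedge x y.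
Proof.
case=> f [[g fK gK] fE]; exists (fun x => val (g x)).
  by move=> x y /val_inj /(can_inj gK).
by move=> x y; rewrite -{2}[x]gK -{2}[y]gK fE.
Qed.

Definition diamond_closed (H : sgraph) :=
  forall x y z t : H, sedge x y -> sedge x z -> sedge y z ->
    sedge x t -> sedge y t -> z != t -> sedge z t.

Definition claw_closed (H : sgraph) :=
  forall v x y z : H, sedge v x -> sedge v y -> sedge v z ->
    x != y -> x != z -> y != z -> [|| sedge x y, sedge x z | sedge y z].

Lemma cliqueP (G : sgraph) (K : {set G}) :
  reflect {in K &, forall x y, x != y -> sedge x y} (clique K).
Proof.
apply: (iffP forall_inP) => [KP x y xK yK|KP x xK].
  by have /forall_inP/(_ y yK)/implyP := KP x xK.
by apply/forall_inP => y yK; apply/implyP; exact: KP.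
Qed.

Lemma clique3 (G : sgraph) (x y z : G) :
  sedge x y -> sedge x z -> sedge y z -> clique [set x; y; z].
Proof.
move=> xy xz yz; apply/cliqueP => s t; rewrite !inE -!orbA.
by case/or3P=> /eqP-> /or3P[] /eqP->; rewrite ?eqxx // => _;
  rewrite // sedge_sym.
Qed.

(** Two maximal cliques with a common edge merge into one clique, as any two vertices outside the
    edge complete a diamond over it. Conversely, the two triangles of a diamond extend to maximal
    cliques sharing [x] and [y], which must coincide. *)
Lemma diamond_closedP (H : sgraph) :
  diamond_closed H <->
  (forall K L : {set H}, maximal_clique K -> maximal_clique L ->
     K != L -> #|K :&: L| <= 1).
Proof.
split=> [dH K L Kmax Lmax | HKL x y z t xy xz yz xt yt zt].
  apply: contraR; rewrite -ltnNge => /card_gt1P [x [y [+ + xy]]].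
  rewrite !inE => /andP[xK xL] /andP[yK yL].
  have [/cliqueP Kc Km] := maxsetP Kmax.
  have [/cliqueP Lc Lm] := maxsetP Lmax.
  have exy : sedge x y by exact: Kc.
  have KL z t : z \in K -> t \in L -> z != t -> sedge z t.
    move=> zK tL zt.
    have [zL|/negP zNL] := boolP (z \in L); first exact: Lc.
    have [tK|/negP tNK] := boolP (t \in K); first exact: Kc.
    apply: (dH x y) => //; [apply: Kc|apply: Kc|apply: Lc|apply: Lc] => //;
      apply/eqP => E; by [apply: zNL; rewrite -E | apply: tNK; rewrite -E].
  have cU : clique (K :|: L).
    apply/cliqueP => z t; rewrite !inE.
    case/orP=> [zK|zL] /orP[tK|tL] zt; [exact: Kc|exact: KL| |exact: Lc].
    by rewrite sedge_sym KL // eq_sym.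
  by rewrite -(Km _ cU (subsetUl K L)) (Lm _ cU (subsetUr K L)).
have [K Kmax /subsetP sK] := maxset_exists (clique3 xy xz yz).
have [L Lmax /subsetP sL] := maxset_exists (clique3 xy xt yt).
have xKL : x \in K :&: L by rewrite inE sK ?sL // !inE eqxx.
have yKL : y \in K :&: L by rewrite inE sK ?sL // !inE eqxx ?orbT.
have Exy : x != y by apply: contraTneq xy => ->; rewrite sedge_irrefl.
have [E|/(HKL _ _ Kmax Lmax)] := eqVneq K L; last first.
  by rewrite leqNgt; case/negP; apply/card_gt1P; exists x, y.
have /cliqueP Kc := maxsetp Kmax.
by apply: Kc => //; [|rewrite E]; rewrite ?sK ?sL // !inE eqxx ?orbT.
Qed.

Lemma claw_closedP (H : sgraph) : claw_closed H <-> graph_free claw H.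
Proof.
split=> [cH [A /not_free_embedding[h h_inj hE]] | fH v x y z vx vy vz xy xz yz].
  pose l i : H := h (inr (inord i) : claw).
  pose c : H := h (inl ord0 : claw).
  have lE i j : sedge (l i) (l j) = false by rewrite hE.
  have cE i : sedge c (l i) by rewrite hE.
  have lD i j : i < 3 -> j < 3 -> (l i == l j) = (i == j).
    move=> i3 j3; rewrite (inj_eq h_inj).
    transitivity (inord i == inord j :> 'I_3); first by [].
    by rewrite -val_eqE /= !inordK.
  by have := @cH c (l 0) (l 1) (l 2); rewrite !lE !cE !lD //= => /(_ isT isT isT isT isT isT).
case: (boolP [|| _, _ | _]) => // /norP[/negbTE Nxy /norP[/negbTE Nxz /negbTE Nyz]].
pose h (s : claw) : H := match s with inl _ => v | inr i => nth x [:: x; y; z] i end.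
have ne s t : sedge s t -> (s == t :> H) = false.
  by move=> st; apply: contraTF st => /eqP->; rewrite sedge_irrefl.
exfalso; apply: (@embedding_not_free claw H h _ _ fH).
  case=> [i|i] [j|j] /=.
  - by rewrite !ord1.
  - by case: j => [[|[|[|//]]] /= ?] /eqP; rewrite ne.
  - by case: i => [[|[|[|//]]] /= ?] /eqP; rewrite eq_sym ne.
  - case: i j => [[|[|[|//]]] /= ?] [[|[|[|//]]] /= ?] /eqP //= E;
      try (by congr inr; apply: val_inj); exfalso; move: E;
      by apply/negP; rewrite // eq_sym.
case=> [i|i] [j|j] /=; rewrite ?sedge_irrefl //.
- by case: j => [[|[|[|//]]] /= ?].
- by case: i => [[|[|[|//]]] /= ?]; rewrite sedge_sym.
- by case: i j => [[|[|[|//]]] /= ?] [[|[|[|//]]] /= ?]; rewrite ?sedge_irrefl // sedge_sym.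
Qed.

(** * Colouring the edges of a tree of cliques *)

(** A shortest counterexample has no repetition and no chord, and none of its inner vertices is
    adjacent to [v]; closed up through [v], it is an induced cycle. *)
Lemma no_walk_around (H : sgraph) (v : H) (n : nat) (f : nat -> H) :
  (forall k, 4 <= k -> graph_free (cycle_graph k) H) -> diamond_closed H ->
  (forall i, i < n -> sedge (f i) (f i.+1)) ->
  (forall i, i <= n -> f i != v) -> sedge v (f 0) -> sedge v (f n) ->
  (f 0 == f n) || sedge (f 0) (f n).
Proof.
move=> cH dH; elim/ltn_ind: n f => n IHn f fE fv v0 vn.
apply/norP => -[f0n Nf0n].
have n_gt1 : 1 < n.
  case: n f0n Nf0n fE {IHn fv vn} => [|[|//]]; first by rewrite eqxx.
  by move=> _ /negP N0 /(_ 0 isT).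
(* Deleting the [m] vertices after [f i] contradicts the induction hypothesis. The last two premises
   glue the remaining pieces, or handle a deleted tail. *)
have short i m : 0 < m -> i + m <= n ->
    (i < n - m -> sedge (f i) (f (i + m).+1)) ->
    (i = n - m -> f i = f n) -> False.
  move=> m_gt0 im_le Ei En; pose g k := if k <= i then f k else f (k + m).
  have gn : g (n - m) = f n.
    rewrite /g; case: leqP => [le_i|_]; last by congr f; lia.
    have E : i = n - m by lia.
    by rewrite -E En.
  have g0 : g 0 = f 0 by [].
  suff : (g 0 == g (n - m)) || sedge (g 0) (g (n - m)).
    by rewrite g0 gn (negbTE f0n) (negbTE Nf0n).
  apply: IHn; rewrite ?gn ?g0 //; first lia.
  - move=> k k_lt; rewrite /g; case: (ltngtP k i) => [|ik|ki].
    + by move=> ki; apply: fE; lia.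
    + by rewrite addSn; apply: fE; lia.
    + by rewrite ki addSn; apply: Ei; rewrite -ki.
  - by move=> k k_le; rewrite /g; case: leqP => _; apply: fv; lia.
have f_inj i j : i < j -> j <= n -> f i != f j.
  move=> ij jn; apply/eqP => fij; apply: (short i (j - i)); try lia.
    move=> Hi; rewrite fij (_ : (i + (j - i)).+1 = j.+1); last lia.
    by apply: fE; lia.
  by move=> Hi; rewrite fij; congr f; lia.
have chord i j : i.+1 < j -> j <= n -> sedge (f i) (f j) = false.
  move=> ij jn; apply/negP => eij; apply: (short i (j - i).-1); try lia.
  by rewrite (_ : (i + (j - i).-1).+1 = j); last lia.
have inner i : 0 < i -> i < n -> sedge v (f i) = false.
  (* By induction on both halves of the walk, [f i] is adjacent to both ends, which gives a diamond
     over the edge from [v] to [f i]. *)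
  move=> i_gt0 i_n; apply/negP => vi.
  have e0i : sedge (f 0) (f i).
    have := IHn i i_n f; rewrite (negbTE (f_inj _ _ i_gt0 (ltnW i_n))).
    by apply=> // k k_lt; [apply: fE | apply: fv]; lia.
  have ein : sedge (f i) (f n).
    have := IHn (n - i) _ (fun k => f (i + k)).
    rewrite addn0 (_ : i + (n - i) = n); last lia.
    rewrite (negbTE (f_inj _ _ i_n (leqnn n))).
    apply=> //; first lia.
    + by move=> k k_lt; rewrite addnS; apply: fE; lia.
    + by move=> k k_le; apply: fv; lia.
  case/negP: Nf0n; apply: (dH v (f i)) => //; by rewrite sedge_sym.
pose h (i : 'I_n.+2) : H := if i <= n then f i else v.
have hE (i j : 'I_n.+2) : i < j -> sedge (h i) (h j) = cycle_edge i j.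
  move=> ij; rewrite /cycle_edge -!val_eqE /= /h.
  have [iN jN] := (ltn_ord i, ltn_ord j).
  rewrite (modn_small (_ : i.+1 < n.+2)); last lia.
  rewrite ifT; last lia.
  case: (leqP j n) => jn.
    rewrite modn_small; last lia.
    have [->|ij1] := eqVneq (j : nat) i.+1; first by rewrite fE /=; lia.
    by rewrite chord; lia.
  have -> : j = n.+1 :> nat by lia.
  rewrite modnn sedge_sym.
  have [->|i_gt0] := posnP i; first by rewrite v0 orbT.
  have [->|i_lt] := eqVneq (i : nat) n; first by rewrite vn eqxx andbT; lia.
  by rewrite inner; lia.
have h_ne (i j : 'I_n.+2) : i < j -> h i != h j.
  move=> ij; have := ltn_ord j => jN; rewrite /h ifT; last lia.
  case: leqP => jn; first exact: f_inj.
  by apply: fv; lia.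
apply: (@embedding_not_free (cycle_graph n.+2) H h _ _ (cH _ _)); last lia.
  move=> i j hij; apply: val_inj; case: (ltngtP i j) => // /h_ne.
    by rewrite hij eqxx.
  by rewrite hij eqxx.
move=> i j; rewrite [RHS]/=; case: (ltngtP i j) => [/hE //|/hE|/val_inj->].
  by rewrite sedge_sym => ->; rewrite cycle_edge_sym.
by rewrite sedge_irrefl cycle_edge_irrefl.
Qed.

(* The local condition says that at every vertex the colour classes of the
   edges are the cliques of its neighbourhood. *)
Definition edge_colouring (H : sgraph) (A : {set H}) (c : H -> H -> bool) :=
  {in A &, forall x y, sedge x y -> c x y = c y x} /\
  {in A & &, forall v x y, sedge v x -> sedge v y -> x != y ->
     (c v x == c v y) = sedge x y}.

Section ExtendColouring.
Variables (H : sgraph) (B : {set H}) (v : H).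
Hypothesis vB : v \notin B.

(** Here [g t] colours the edge from [v] to [t]. The two conditions on [g] are the instances of the
    local condition that involve [v]: at [v] itself, and at a neighbour of [v]. *)
Lemma edge_colouring_extend (c : H -> H -> bool) (g : H -> bool) :
  edge_colouring B c ->
  {in B &, forall x y, sedge v x -> sedge v y -> x != y ->
     (g x == g y) = sedge x y} ->
  {in B &, forall x y, sedge v x -> sedge x y -> (g x == c x y) = sedge v y} ->
  edge_colouring (v |: B)
    (fun s t => if s == v then g t else if t == v then g s else c s t).
Proof.
move=> [c_sym cB] gv gB; have neB x : x \in B -> (x == v) = false.
  by move=> xB; apply: contraNF vB => /eqP<-.
split=> [x y|w x y]; rewrite !inE.
  case: (eqVneq x v) => [->|_] /=; case: (eqVneq y v) => [->|_] //=.
  exact: c_sym.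
case: (eqVneq w v) => [->|_] /=.
  case: (eqVneq x v) => [->|_] /=; first by rewrite sedge_irrefl.
  case: (eqVneq y v) => [->|_] /=; first by rewrite sedge_irrefl.
  by move=> _; apply: gv.
case: (eqVneq x v) => [->|_]; case: (eqVneq y v) => [->|_] //=.
- by move=> wB _ yB wv wy _; apply: gB => //; rewrite sedge_sym.
- move=> wB xB _ wx wv _; rewrite eq_sym [RHS]sedge_sym.
  by apply: gB => //; rewrite sedge_sym.
- exact: cB.
Qed.

End ExtendColouring.

Lemma edge_colouring_exists (H : sgraph) (A : {set H}) :
  (forall k, 4 <= k -> graph_free (cycle_graph k) H) ->
  diamond_closed H -> claw_closed H -> exists c, edge_colouring A c.
Proof.
move=> cH dH kH; have [n] := ubnP #|A|; elim: n A => // n IHn A.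
rewrite ltnS => A_le; have [->|[v vA]] := set_0Vmem A.
  by exists (fun _ _ => true); split=> ?; rewrite ?inE // => ?; rewrite !inE.
pose B := A :\ v; have vB : v \notin B by rewrite !inE eqxx.
have [|c [c_sym cB]] := IHn B.
  by move: A_le; rewrite (cardsD1 v) vA.
rewrite -(setD1K vA) -/B.
(* Without diamonds, adjacency is transitive on the neighbours of [w]. *)
have ntrans (w x y z : H) : sedge w x -> sedge w y -> sedge w z -> sedge x y ->
    sedge y z -> x != z -> sedge x z.
  by move=> wx wy wz xy yz xz; apply: (dH w y) => //; rewrite sedge_sym.
have neB x : x \in B -> (x == v) = false.
  by move=> xB; apply: contraNF vB => /eqP<-.
(* For a neighbour [x] of [v], the local condition at [x] forces the colour of the edge to [v] as
   soon as [x] has one neighbour in [B]; otherwise the colour is free. *)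
pose g x := if [pick y | (y \in B) && sedge x y] is Some y
            then (c x y == sedge v y) else true.
have gB : {in B &, forall x y, sedge v x -> sedge x y ->
            (g x == c x y) = sedge v y}.
  move=> x y xB yB vx xy; rewrite /g; case: pickP => [z /andP[zB xz]|]; last first.
    by move/(_ y); rewrite yB xy.
  have [<-|yz] := eqVneq y z; first by case: (c x y) (sedge v y) => [] [].
  have xv : sedge x v by rewrite sedge_sym.
  (* The forced colour does not depend on the neighbour picked: [v], [y], [z] are neighbours of [x],
     which span at most two cliques as there is no claw. *)
  suff : sedge y z = (sedge v y == sedge v z).
    rewrite -(cB x) //.
    by case: (c x y) (c x z) (sedge v y) (sedge v z) => [] [] [] [].
  case vy: (sedge v y); case vz: (sedge v z) => /=.
  - by apply: (ntrans x y v z) => //; rewrite sedge_sym.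
  - apply/negP => eyz; case/negP: (negbT vz); apply: (ntrans x v y z) => //.
    by rewrite eq_sym neB.
  - apply/negP => eyz; case/negP: (negbT vy); apply: (ntrans x v z y) => //.
      by rewrite sedge_sym.
    by rewrite eq_sym neB.
  - have := kH x v y z xv xy xz; rewrite vy vz /=; apply=> //;
      by rewrite eq_sym neB.
have gN : {in B &, forall x y, sedge v x -> sedge v y -> sedge x y -> g x = g y}.
  move=> x y xB yB vx vy xy.
  have /eqP-> : g x == c x y by rewrite gB.
  have /eqP-> : g y == c y x by rewrite gB // sedge_sym.
  exact: c_sym.
pose N x := (x \in B) && sedge v x.
pose q (x y : H) := (x == y) || sedge x y.
(* If the neighbours of [v] in [B] form one clique, [g] already works. Otherwise [x0] and [y0]
   represent the two cliques. *)
have [/existsP[x0 /existsP[y0 /and3P[/andP[x0B vx0] /andP[y0B vy0] Nxy]]]|Nq] :=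
  boolP [exists x, exists y, [&& N x, N y & ~~ q x y]]; last first.
  exists (fun s t => if s == v then g t else if t == v then g s else c s t).
  apply: edge_colouring_extend => // x y xB yB vx vy xy.
  suff exy : sedge x y by rewrite exy (gN x y) ?eqxx.
  move: Nq; rewrite negb_exists => /forallP/(_ x); rewrite negb_exists.
  by move/forallP/(_ y); rewrite /N xB yB vx vy /= negbK /q (negbTE xy).
pose r := [rel s t | [&& s \in B, t \in B & sedge s t]].
pose C x := connect r x0 x.
have C_edge x y : x \in B -> y \in B -> sedge x y -> C x = C y.
  move=> xB yB xy; apply/idP/idP => Cx; apply: connect_trans Cx (connect1 _);
    by rewrite /= xB yB // sedge_sym.
(* A path inside [B] avoids [v], so the component of [x0] meets the neighbourhood of [v] only in the
   clique of [x0]. *)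
have C_N x : x \in B -> sedge v x -> C x = q x0 x.
  move=> xB vx; apply/idP/idP; last first.
    case/orP=> [/eqP<-|x0x]; first exact: connect0.
    by rewrite -(C_edge x0 x) // /C connect0.
  case/connectP=> p px xE; pose f i := nth x0 (x0 :: p) i.
  have fn : f (size p) = x by rewrite xE /f nth_last.
  rewrite /q -fn -[x0]/(f 0); apply: (no_walk_around (v := v)) => //.
  - by move=> i i_lt; have /(pathP x0)/(_ i i_lt)/and3P[] := px.
  - move=> [_|i i_le]; first by rewrite neB.
    have /(pathP x0)/(_ i i_le)/and3P[_ fB _] := px.
    by rewrite -[f _]/(nth x0 p i) neB.
  - by rewrite fn.
have addbE b b1 b2 : (b1 (+) b == b2 (+) b) = (b1 == b2).
  by case: b b1 b2 => [] [] [].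
(* If both cliques are forced to the same colour, swap colours outside the component of [x0]. As
   [flip] is constant along edges of [B], the old conditions survive. *)
pose flip x := (g x0 == g y0) && ~~ C x.
pose c' s t := c s t (+) flip s; pose g' s := g s (+) flip s.
exists (fun s t => if s == v then g' t else if t == v then g' s else c' s t).
apply: edge_colouring_extend => //.
- split=> [x y xB yB xy|w x y wB xB yB wx wy xy].
    by rewrite /c' /flip (C_edge x y) // c_sym.
  by rewrite -(cB w) // /c' addbE.
- move=> x y xB yB vx vy xy.
  have [exy|nexy] := boolP (sedge x y).
    by rewrite /g' /flip (C_edge x y) // (gN x y) ?eqxx.
  have N0 z : z \in B -> sedge v z -> q x0 z -> g' z = g x0.
    move=> zB vz x0z; rewrite /g' /flip C_N // x0z andbF addbF.
    by case/orP: x0z => [/eqP->|x0z] //; apply/esym/gN.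
  have N1 z : z \in B -> sedge v z -> ~~ q x0 z -> g' z = ~~ g x0.
    move=> zB vz /[dup] Nx0z /negbTE Ex0z; rewrite /g' /flip C_N // Ex0z andbT.
    have -> : g z = g y0.
      have [->//|zy0] := eqVneq z y0; apply: gN => //.
      move: Nx0z Nxy; rewrite /q => /norP[x0z /negbTE Nx0z] /norP[x0y /negbTE Nx0y].
      by have := kH v x0 z y0 vx0 vz vy0 x0z x0y zy0; rewrite Nx0z Nx0y.
    by case: (g x0) (g y0) => [] [].
  have [x0x|Nx0x] := boolP (q x0 x); have [x0y|Nx0y] := boolP (q x0 y).
  + case/negP: nexy; move: x0x x0y; rewrite /q.
    case: eqVneq => [->|x0x] /=; first by rewrite (negbTE xy).
    case: eqVneq => [->|x0y] /=; first by rewrite sedge_sym.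
    move=> ex ey; apply: (ntrans v x x0 y) => //; by rewrite sedge_sym.
  + by rewrite N0 // N1 //; case: (g x0).
  + by rewrite N1 // N0 //; case: (g x0).
  + case/negP: nexy; move: Nx0x Nx0y; rewrite /q.
    move=> /norP[x0x /negbTE Nx] /norP[x0y /negbTE Ny].
    by have := kH v x0 x y vx0 vx vy x0x x0y xy; rewrite Nx Ny.
- move=> x y xB yB vx xy; rewrite /g' /c' addbE; exact: gB.
Qed.

(** * Graphs of words closed under splicing *)

Section WordModel.
Variables (H : sgraph) (T : Type) (W : H -> nat -> T).

Definition differ_at i x y := x <> y /\ forall k, k <> i -> W x k = W y k.

Hypothesis W_edge : forall x y, sedge x y <-> exists i, differ_at i x y.
Hypothesis W_inj : forall x y, (forall k, W x k = W y k) -> x = y.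
Hypothesis W_splice : forall x y m, W x m = W y m ->
  exists z, forall k, W z k = if k <= m then W x k else W y k.

Lemma differ_atP i x y : differ_at i x y -> W x i <> W y i.
Proof.
case=> xy E Ei; apply/xy/W_inj => k.
by have [->|/eqP] := eqVneq k i; last exact: E.
Qed.

(** If [i] and [j] were distinct, [y] and [z] would differ at both levels. *)
Lemma differ_at_triangle i j x y z :
  differ_at i x y -> differ_at j x z -> sedge y z -> i = j.
Proof.
move=> xy xz /W_edge[k [_ yz]]; have [//|/eqP ij] := eqVneq i j.
have [Nxy Nxz] := (differ_atP xy, differ_atP xz).
case: xy xz => [_ xy] [_ xz].
have [ki|/eqP/nesym/yz E] := eqVneq k i; last by case: Nxy; rewrite E xz.
have /yz E : j <> k by rewrite ki; exact/nesym.
by case: Nxz; rewrite -E xy //; exact/nesym.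
Qed.

Lemma word_diamond_closed : diamond_closed H.
Proof.
move=> x y z t /W_edge[i xy] /W_edge[j xz] yz /W_edge[k xt] yt zt.
have ij := differ_at_triangle xy xz yz; have ik := differ_at_triangle xy xt yt.
apply/W_edge; exists i; split=> [|m mi]; first exact/eqP.
by rewrite -(proj2 xz) -?ij // -(proj2 xt) -?ik.
Qed.

(* Replacements at two levels that are not consecutive commute, so they span
   a four-cycle. *)
Lemma word_square i j c x y :
  i.+1 < j -> differ_at i c x -> differ_at j c y ->
  ~ graph_free (cycle_graph 4) H.
Proof.
move=> ij cx cy; have [Ncx Ncy] := (differ_atP cx, differ_atP cy).
have two (s t : H) : W s i <> W t i -> W s j <> W t j -> s <> t /\ sedge s t = false.
  move=> Ni Nj; split=> [E|]; first by apply: Ni; rewrite E.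
  apply/negP => /W_edge[k [_ E]].
  have [ki|/eqP/nesym/E //] := eqVneq k i.
  by apply/Nj/E; rewrite ki; lia.
have [_ Ex] := cx; have [_ Ey] := cy.
(* Level [i.+1] lies strictly between [i] and [j], so [x] and [y] both agree with [c] there; [z]
   carries both replacements. *)
have [|z zE] := @W_splice x y i.+1; first by rewrite -Ex -?Ey //; lia.
have zi : W z i = W x i by rewrite zE leqnSn.
have zj : W z j = W y j by rewrite zE leqNgt ij.
have xj : W x j = W c j by rewrite Ex //; lia.
have yi : W y i = W c i by rewrite Ey //; lia.
have [zc Nzc] : z <> c /\ sedge z c = false.
  by apply: two; rewrite ?zi ?zj; exact/nesym.
have [xy Nxy] : x <> y /\ sedge x y = false.
  by apply: two; rewrite ?xj ?yi //; exact/nesym.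
have ecx : sedge c x by apply/W_edge; exists i.
have ecy : sedge c y by apply/W_edge; exists j.
have exz : sedge x z.
  apply/W_edge; exists j; split=> [E|k kj].
    by apply: Ncy; rewrite -zj -E xj.
  by rewrite zE; case: leqP => // ki; rewrite -Ex -?Ey //; lia.
have eyz : sedge y z.
  apply/W_edge; exists i; split=> [E|k ki].
    by apply: Ncx; rewrite -zi -E yi.
  by rewrite zE; case: leqP => // kl; rewrite -Ex -?Ey //; lia.
have ne (s t : H) : sedge s t -> s <> t by move=> + E; rewrite E sedge_irrefl.
have [ncx ncy nxz nyz] := And4 (ne _ _ ecx) (ne _ _ ecy) (ne _ _ exz) (ne _ _ eyz).
have [Ncz Nyx] : sedge c z = false /\ sedge y x = false.
  by rewrite sedge_sym Nzc sedge_sym Nxy.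
have [exc [eyc [ezx ezy]]] : sedge x c /\ sedge y c /\ sedge z x /\ sedge z y.
  by do !split; rewrite sedge_sym.
apply: (@embedding_not_free (cycle_graph 4) H (fun i => nth c [:: c; x; z; y] i)).
  case=> [[|[|[|[|//]]]] ?] [[|[|[|[|//]]]] ?] //= E;
    by apply: val_inj => //; exfalso; move: E; auto.
by case=> [[|[|[|[|//]]]] ?] [[|[|[|[|//]]]] ?] /=; rewrite ?sedge_irrefl //.
Qed.

(** Neighbours of [v] at the same level are adjacent, and distinct levels must be consecutive; three
    distinct numbers are not pairwise consecutive. *)
Lemma word_claw_closed : graph_free (cycle_graph 4) H -> claw_closed H.
Proof.
move=> C4 v x y z /W_edge[i vx] /W_edge[j vy] /W_edge[k vz] xy xz yz.
have same (s t : H) m : differ_at m v s -> differ_at m v t -> s != t -> sedge s t.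
  move=> [_ vs] [_ vt] /eqP st; apply/W_edge; exists m; split=> // n nm.
  by rewrite -vs // vt.
have close (s t : H) m n : differ_at m v s -> differ_at n v t -> n <= m.+1.
  by move=> vs vt; rewrite leqNgt; apply/negP => /word_square; apply; eauto.
have [ij|ij] := eqVneq i j; first by rewrite (same x y i) // ij.
have [ik|ik] := eqVneq i k; first by rewrite (same x z i) ?orbT // ik.
have [jk|jk] := eqVneq j k; first by rewrite (same y z j) ?orbT // jk.
have := (close _ _ _ _ vx vy, close _ _ _ _ vy vx, close _ _ _ _ vx vz).
have := (close _ _ _ _ vz vx, close _ _ _ _ vy vz, close _ _ _ _ vz vy).
by case=> [[? ?] ?] [[? ?] ?]; exfalso; lia.
Qed.

End WordModel.

(** * Geodesics as words *)

Section Splice.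
Variables (G : sgraph) (a b : G).
Implicit Types p q : seq G.

Lemma last_take_nth p i : i <= size p -> last a (take i p) = nth b (a :: p) i.
Proof.
move=> ip; rewrite (last_nth b) size_takel //.
by case: i ip => // i ip; rewrite /= nth_take.
Qed.

Lemma splice_walk p q i j :
  i <= size p -> j <= size q -> nth b (a :: p) i = nth b (a :: q) j ->
  path (@sedge G) a p -> path (@sedge G) a q ->
  path (@sedge G) a (take i p ++ drop j q) /\
  last a (take i p ++ drop j q) = last a q.
Proof.
move=> ip jq E Pp; rewrite -{1 4}(cat_take_drop j q) cat_path => /andP[_ Pq].
rewrite cat_path !last_cat last_take_nth // E -last_take_nth // Pq andbT.
by move: Pp; rewrite -{1}(cat_take_drop i p) cat_path => /andP[].
Qed.

(** Minimality extends from bounded simple paths to all walks, since a walk shortens to a simple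
    path. *)
Lemma geodesic_min (p : {bseq #|G| of G}) q :
  geodesic a b p -> path (@sedge G) a q -> last a q = b ->
  size (val p) <= size q.
Proof.
case/andP=> _ /forallP pmin qP; case: (shortenP qP) => q' q'P q'U sub q'b.
have q'G : size q' <= #|G|.
  by move: q'U => /= /andP[_ /card_uniqP <-]; exact: max_card.
have q'ab : is_path a b q' by rewrite /is_path q'P q'b eqxx q'U.
have /implyP/(_ q'ab)/leq_trans := pmin (Bseq q'G); apply.
by move: q'U; rewrite cons_uniq => /andP[_ Uq']; exact: uniq_leq_size.
Qed.

Definition walk (u : spg_vertex a b) : seq G := val (val u).

Lemma walk_min (u : spg_vertex a b) q :
  path (@sedge G) a q -> last a q = b -> size (walk u) <= size q.
Proof. exact: geodesic_min (valP u). Qed.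

(** Level 0 is [a]. The default [b] pads every geodesic with the same constant tail, so two of them
    never differ past their end. *)
Definition level (u : spg_vertex a b) k := nth b (a :: walk u) k.

Lemma geodesicP (u : spg_vertex a b) :
  [/\ path (@sedge G) a (walk u), last a (walk u) = b &
      uniq (a :: walk u)].
Proof. by rewrite /walk; case: u => p /= /andP[/and3P[? /eqP ? ?] _]. Qed.

Lemma size_geodesic (u v : spg_vertex a b) :
  size (walk u) = size (walk v).
Proof.
apply/eqP; rewrite eqn_leq.
have [Pu lu _] := geodesicP u; have [Pv lv _] := geodesicP v.
by rewrite walk_min // (walk_min v).
Qed.

Lemma level_inj (u v : spg_vertex a b) : (forall k, level u k = level v k) -> u = v.
Proof.
move=> E; apply/val_inj/val_inj/(eq_from_nth (x0 := b)) => [|i _].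
  exact: size_geodesic.
exact: (E i.+1).
Qed.

Lemma level_default (u v : spg_vertex a b) k :
  size (walk u) < k -> level v k = b.
Proof. by move=> k_gt; apply: nth_default; rewrite /= -(size_geodesic u). Qed.

(** Following [u] up to level [i] and then [v] from level [j] gives a walk from [a] to [b], which
    would be too short if [i < j]. *)
Lemma level_eq (u v : spg_vertex a b) i j :
  i <= size (walk u) -> j <= size (walk v) ->
  level u i = level v j -> i = j.
Proof.
wlog suff le_ij : u v i j / i <= size (walk u) ->
    j <= size (walk v) -> level u i = level v j -> j <= i.
  by move=> iu jv E; apply/eqP; rewrite eqn_leq (le_ij v u) // (le_ij u v).
move=> iu jv E; have [Pu lu _] := geodesicP u; have [Pv lv _] := geodesicP v.
have [wP wl] := splice_walk iu jv E Pu Pv.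
have := walk_min v wP; rewrite wl lv => /(_ erefl).
by rewrite size_cat size_takel // size_drop; lia.
Qed.

Lemma level_splice (u v : spg_vertex a b) m : level u m = level v m ->
  exists z : spg_vertex a b,
    forall k, level z k = if k <= m then level u k else level v k.
Proof.
move=> E; have [m_le|m_gt] := leqP m (size (walk u)); last first.
  exists u => k; case: leqP => // mk.
  by rewrite !(level_default (u := u)) //; lia.
have m_lev : m <= size (walk v) by rewrite (size_geodesic v u).
have [Pu lu Uu] := geodesicP u; have [Pv lv Uv] := geodesicP v.
have [wP wl] := splice_walk m_le m_lev E Pu Pv.
set w := _ ++ _ in wP wl.
have w_size : size w = size (walk u).
  by rewrite size_cat size_takel // size_drop (size_geodesic v u) subnKC.
have wG : size w <= #|G| by rewrite w_size; exact: size_bseq.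
(* Shortening [w] to a simple path cannot reduce its length, which is already minimal; so [w] has no
   repetition. *)
have wU : uniq (a :: w).
  have wb : last a w = b by rewrite wl.
  case: (shortenP wP) wb => q qP qU sub qb.
  apply: leq_size_uniq qU _ _.
    by move=> x; rewrite !inE => /orP[->//|/sub->]; rewrite orbT.
  by rewrite /= ltnS w_size; exact: walk_min qP qb.
have wg : geodesic a b (Bseq wG).
  rewrite /geodesic /is_path /= wP wl lv eqxx /=.
  move: wU => /= -> /=; apply/forallP => q; apply/implyP => /and3P[qP /eqP ql _].
  by rewrite w_size; exact: walk_min qP ql.
exists (exist _ (Bseq wG) wg) => k; rewrite /level /=.
case: k => // k; rewrite /= nth_cat size_takel //.
case: ltnP => km; first by rewrite nth_take.
by rewrite nth_drop; congr nth; lia.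
Qed.

(** A vertex determines its level, so the vertices of [u] missing from [v] correspond to the levels
    where the words differ. *)
Lemma card_geodesicD (u v : spg_vertex a b) : u <> v ->
  #|path_vertices a (val u) :\: path_vertices a (val v)| == 1 <->
  exists i, forall k, k <> i -> level u k = level v k.
Proof.
have memP (z : spg_vertex a b) x : reflect
    (exists2 k, k <= size (walk z) & level z k = x)
    (x \in path_vertices a (val z)).
  by rewrite inE; apply: (iffP (nthP b)).
have memD k : k <= size (walk u) ->
    level u k \in path_vertices a (val u) :\: path_vertices a (val v) <->
    level u k <> level v k.
  move=> ku; rewrite inE; split=> [/andP[/memP vk _] E|E].
    by apply: vk; exists k; rewrite // (size_geodesic v u).
  apply/andP; split; last by apply/memP; exists k.
  apply/memP => -[j jv jE]; have kj := level_eq jv ku jE.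
  by apply: E; rewrite -jE kj.
move=> uv; split=> [/cards1P[x Ex]|[i Ei]].
  have : x \in path_vertices a (val u) :\: path_vertices a (val v).
    by rewrite Ex set11.
  rewrite inE => /andP[_ /memP[i iu ix]]; exists i => k ki.
  have [ku|ku] := leqP k (size (walk u)); last first.
    by rewrite !(level_default (u := u)).
  apply/eqP/contraT => /eqP /(memD k ku); rewrite Ex inE -ix => /eqP.
  by move/(level_eq ku iu).
have Ni : level u i <> level v i.
  move=> E; apply/uv/level_inj => k.
  by have [->|/eqP] := eqVneq k i; last exact: Ei.
have iu : i <= size (walk u).
  rewrite leqNgt; apply/negP => i_gt.
  by apply: Ni; rewrite !(level_default (u := u)).
apply/cards1P; exists (level u i); apply/setP => x; rewrite in_set1.
apply/idP/eqP => [/[dup]|->]; last exact/memD.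
rewrite {1}inE => /andP[_ /memP[k ku <-]] /(memD k ku) Nk.
by have [->//|/eqP/Ei] := eqVneq k i.
Qed.

Lemma spg_edgeP (u v : spg_vertex a b) :
  spg_edge u v <-> exists i, differ_at (H := shortest_path_graph a b) level i u v.
Proof.
split=> [uv|[i [uv E]]].
  have Nuv : u <> v by move=> E; move: uv; rewrite E spg_edge_irrefl.
  by case/andP: uv => /(card_geodesicD Nuv)[i E] _; exists i.
apply/andP; split; first by apply/card_geodesicD => //; exists i.
by apply/card_geodesicD; [exact/nesym | exists i => k /E].
Qed.

End Splice.

(** * Line graphs of bipartite graphs as shortest path graphs *)

Lemma bijective_onto (T U : finType) (f : T -> U) :
  injective f -> (forall u, exists x, f x = u) -> bijective f.
Proof.
move=> f_inj f_onto; have fP u : u \in codom f.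
  by have [x <-] := f_onto u; exact: codom_f.
exists (fun u => iinv (fP u)) => [x|u]; last exact: f_iinv.
by apply: f_inj; rewrite f_iinv.
Qed.

Section LayeredGraph.
Variables (H : sgraph) (X Y : finType) (l : H -> X) (r : H -> Y).

(** Arcs point from the source [inl false] to the target [inl true]. The middle layers form the
    bipartite graph whose edges are the vertices [v] of [H], with ends [l v] and [r v]. *)
Definition layer_arc (s t : bool + (X + Y)) : bool :=
  match s, t with
  | inl false, inr (inl _) => true
  | inr (inl x), inr (inr y) => [exists v, (l v == x) && (r v == y)]
  | inr (inr _), inl true => true
  | _, _ => false
  end.

Definition layer_edge s t := layer_arc s t || layer_arc t s.

Lemma layer_edge_sym : symmetric layer_edge.
Proof. by move=> s t; rewrite /layer_edge orbC. Qed.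

Lemma layer_edge_irrefl : irreflexive layer_edge.
Proof. by case=> [[]|[]]. Qed.

Definition layered_graph : sgraph := SGraph layer_edge_sym layer_edge_irrefl.

Let source : layered_graph := inl false.
Let target : layered_graph := inl true.
Let route v : seq layered_graph := [:: inr (inl (l v)); inr (inr (r v)); target].

Lemma route_path v : is_path source target (route v).
Proof.
rewrite /is_path /= /layer_edge /= !andbT orbF.
by apply/existsP; exists v; rewrite !eqxx.
Qed.

Lemma layered_pathP p : is_path source target p ->
  exists v q, p = [:: inr (inl (l v)), inr (inr (r v)) & q] /\ 0 < size q.
Proof.
case: p => [|[[]|[x|y']] [|[[]|[x'|y]] q]] //.
(* Here the path returns to [source], which only [uniq] forbids. *)
- by rewrite /is_path cons_uniq !inE eqxx orbT !andbF.
rewrite /is_path /= => /and3P[/andP[+ _] + _].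
rewrite /layer_edge /= orbF => /existsP[v /andP[/eqP<- /eqP<-]] qP.
by exists v, q; split=> //; case: q qP.
Qed.

Lemma route_size v : size (route v) <= #|layered_graph|.
Proof.
have /and3P[_ _] := route_path v; rewrite cons_uniq => /andP[_ /card_uniqP<-].
exact: max_card.
Qed.

Lemma route_geodesic v : geodesic source target (Bseq (route_size v)).
Proof.
rewrite /geodesic route_path; apply/forallP => q; apply/implyP.
by case/layered_pathP => w [q' [-> q'_gt0]].
Qed.

Definition layered_geodesic v : shortest_path_graph source target :=
  exist _ (Bseq (route_size v)) (route_geodesic v).

Hypothesis lr_inj : forall u v, l u = l v -> r u = r v -> u = v.
Hypothesis lr_edge : forall u v, u != v ->
  sedge u v = (l u == l v) || (r u == r v).

Lemma layered_geodesic_inj : injective layered_geodesic.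
Proof.
move=> u v /(congr1 (fun z => walk z)).
by rewrite /walk /= => -[lE rE]; exact: lr_inj.
Qed.

Lemma layered_geodesic_onto u : exists v, layered_geodesic v = u.
Proof.
have [Pu lu Uu] := geodesicP u.
have up : is_path source target (walk u) by rewrite /is_path Pu lu eqxx Uu.
have [v [q [uE q_gt0]]] := layered_pathP up; exists v.
apply/val_inj/val_inj; rewrite /= -/(walk u) uE; congr [:: _, _ & _].
have /and3P[vP /eqP vl _] := route_path v.
(* Comparison with the route of [v] leaves a single vertex in [q], and it is the target. *)
have := walk_min u vP vl; move: lu; rewrite uE /=.
by case: q q_gt0 {uE} => [|x [|y q]] // _ /= ->.
Qed.

Lemma layered_spg : is_spg H.
Proof.
exists layered_graph, source, target; split=> //; exists layered_geodesic.
split; first exact: bijective_onto layered_geodesic_inj layered_geodesic_onto.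
move=> u v; have [->|uv] := eqVneq u v; first by rewrite !sedge_irrefl.
have ne : layered_geodesic u <> layered_geodesic v.
  by move/layered_geodesic_inj; exact/eqP.
rewrite lr_edge //; apply/idP/orP => [/spg_edgeP[i [_ E]]|].
  have := (E 1, E 2); rewrite /level /= => -[E1 E2].
  have [i1|/eqP/nesym/E1 [->]] := eqVneq i 1; last by left.
  have /E2 [->] : 2 <> i by rewrite i1.
  by right.
(* Level 1 carries [l] and level 2 carries [r]; sharing one label leaves the other level to
   differ. *)
move=> lr; apply/spg_edgeP; case: lr => /eqP E; [exists 2|exists 1]; split=> //.
  by case=> [|[|[|k]]] //; rewrite /level /= E.
by case=> [|[|[|k]]] //; rewrite /level /= E.
Qed.

End LayeredGraph.

(** The reflexive closure of [R] is an equivalence, and the two sets are its classes. *)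
Lemma class_eq (T : finType) (R : rel T) : symmetric R ->
  (forall x y z, R x y -> R x z -> y != z -> R y z) ->
  forall x y, ([set z | (z == x) || R x z] == [set z | (z == y) || R y z])
    = (x == y) || R x y.
Proof.
move=> Rs Rt x y; apply/eqP/orP => [/setP/(_ y)|[/eqP->//|xy]].
  by rewrite !inE eqxx /= eq_sym => /orP.
have sub u v z : R u v -> (z == u) || R u z -> (z == v) || R v z.
  move=> uv /orP[/eqP->|uz]; first by rewrite Rs uv orbT.
  by have [//|vz] := eqVneq z v; rewrite (Rt u) // eq_sym.
by apply/setP => z; rewrite !inE; apply/idP/idP; apply: sub; rewrite // Rs.
Qed.

(** * The two implications *)

Lemma tree_of_cliques_spg (H : sgraph) : tree_of_cliques H -> is_spg H.
Proof.
case=> cH /claw_closedP kH /diamond_closedP dH.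
have [c [c_sym cP]] := edge_colouring_exists [set: H] cH dH kH.
pose R (b : bool) (x y : H) := sedge x y && (c x y == b).
have Rs b : symmetric (R b).
  move=> x y; rewrite /R sedge_sym; case yx: (sedge y x) => //=.
  by rewrite c_sym ?inE // sedge_sym.
have Rt b x y z : R b x y -> R b x z -> y != z -> R b y z.
  move=> /andP[xy /eqP cxy] /andP[xz /eqP cxz] yz; rewrite /R.
  have yx : sedge y x by rewrite sedge_sym.
  have eyz : sedge y z by rewrite -(cP x) ?inE // cxy cxz.
  have x_z : x != z by apply: contraTneq xz => ->; rewrite sedge_irrefl.
  have : c y x == c y z by rewrite (cP y) ?inE.
  by rewrite eyz c_sym ?inE // cxy eq_sym.
(* The clique of colour [b] through [x]; cliques of the two colours are the two sides of the
   bipartite graph. *)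
pose K b x := [set z | (z == x) || R b x z].
have KE b x y : x != y -> (K b x == K b y) = R b x y.
  by move=> /negbTE xy; rewrite (class_eq (Rs b) (@Rt b)) xy.
apply: (@layered_spg H _ _ (K true) (K false)) => [x y /eqP K1 /eqP K2|x y xy].
  (* Two distinct vertices with the same cliques would be joined by an edge of both colours. *)
  apply/eqP/contraT => xy; move: K1 K2; rewrite !KE // /R.
  by case: (c x y); rewrite !andbF.
by rewrite !KE // -andb_orr; case: (c x y); rewrite andbT.
Qed.

Lemma spg_tree_of_cliques (H : sgraph) :
  (forall k, 4 <= k -> graph_free (cycle_graph k) H) ->
  is_spg H -> tree_of_cliques H.
Proof.
move=> cH [G [a [b [_ [f [[g fK gK] fE]]]]]].
pose W (x : H) := level (f x).
have W_edge x y : sedge x y <-> exists i, differ_at W i x y.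
  rewrite -fE; split=> [/spg_edgeP|] [i [xy E]].
    by exists i; split=> // xy'; apply: xy; rewrite xy'.
  by apply/spg_edgeP; exists i; split=> // /(can_inj fK).
have W_inj x y : (forall k, W x k = W y k) -> x = y.
  by move/level_inj/(can_inj fK).
have W_splice x y m : W x m = W y m ->
    exists z, forall k, W z k = if k <= m then W x k else W y k.
  by case/level_splice=> z zE; exists (g z) => k; rewrite /W gK zE.
split=> //.
- by apply/claw_closedP; apply: (word_claw_closed W_edge W_inj W_splice); exact: cH.
- by apply/diamond_closedP; exact: word_diamond_closed W_edge W_inj.
Qed.

Theorem theorem15 (H : sgraph)
  (H_cycle_free : forall k : nat, 4 <= k -> graph_free (cycle_graph k) H) :
  is_spg H <-> tree_of_cliques H.
Proof.
by split; [exact: spg_tree_of_cliques | exact: tree_of_cliques_spg].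
Qed.
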